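(* For every integer $d\geq 2$ there exists a polynomial $f_d(x) \in \mathbb{Q}[x]$ such that $2\leq \deg(f_d) \leq d$ and all of the following hold: (1) $f_d(x)$ has at least $d + \lfloor \log_2(d)\rfloor$ rational preperiodic points, i.e. $|\mathrm{PrePer}(f_d,\mathbb{Q})| \geq d + \lfloor \log_2(d)\rfloor$; (2) for all integers $i,j$ with $0 \le i < j \le \log_2(d)$, \[ \left|\mathrm{PrePer}(f_{d}(x)+i,\mathbb{C}) \cap \mathrm{PrePer}(f_{d}(x)+j,\mathbb{C})\right| < \infty; \] (3) \[ \left|\bigcap_{i=0}^{\lfloor \log_2(d)\rfloor} \mathrm{PrePer}(f_{d}(x) + i,\mathbb{C}) \right| \ge \deg(f_{d})(d - 1) + 1. \]
   Context: For a field $K$ and a polynomial $f(x)\in K[x]$, $f^n$ denotes the $n$-fold composition of $f$ with itself. A point $\alpha$ is preperiodic under $f$ if the orbit $\{f^n(\alpha) : n\geq 0\}$ is finite. $\mathrm{PrePer}(f,K)$ denotes the set of $\alpha\in K$ that are preperiodic under $f$ (the point $\infty$ is not counted). *)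

(* Defs.v *)
From HB Require Import structures.
From mathcomp Require Import all_boot all_order all_algebra.
From mathcomp Require Import boolp classical_sets functions cardinality reals.
From mathcomp Require Import complex.

Set Implicit Arguments.
Unset Strict Implicit.
Unset Printing Implicit Defensive.

Import Order.TTheory GRing.Theory Num.Theory.

Local Open Scope classical_set_scope.
Local Open Scope ring_scope.

Definition orbit_of (K : fieldType) (f : {poly K}) (a : K) : set K :=
  range (fun n : nat => iter n (horner f) a).

Definition preperiodic (K : fieldType) (f : {poly K}) (a : K) : Prop :=
  finite_set (orbit_of f a).

Definition PrePer (K : fieldType) (f : {poly K}) : set K :=
  [set a | preperiodic f a].

(* The polynomial f + c with f over the rationals, viewed over a larger field,
   so that PrePer (shift_over L f c) is PrePer(f + c, L). *)
Definition shift_over (L : fieldType) (f : {poly rat}) (c : nat) : {poly L} :=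
  map_poly ratr (f + (c%:R)%:P).

(* Main.v *)
(** Let [k] be the integer part of [log_2 d].

    A pigeonhole argument on integer-valued functions on [{0, ..., d + k - 1}]
    with small values, against the [k - 1] finite differences of order [d + 1],
    yields a nonconstant polynomial [f] of degree at most [d] that maps
    [{0, ..., d + k - 1}] into [{0, ..., d - 1}].  Then every [f + i] with
    [i <= k] preserves [{0, ..., d + k - 1}], so all complex preimages under [f]
    of [0, ..., d - 1] are preperiodic for every [f + i]; the critical points
    of [f] cost at most [deg f - 1] of the [d * deg f] preimages.

    For the finiteness of the common preperiodic points of [g] and [h = g + c],
    instead of equidistribution one uses a Fekete argument.  The iterates of a
    point of this set [S] are bounded, and algebraic integers up to a fixed
    denominator.  Let [D = deg g].  The difference [T] of the [n]-th iterates of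
    [g] and [h] is bounded on [S] uniformly in [n], while its leading coefficient
    exceeds the one expected from the capacity of the filled Julia set of [g] by
    a factor [c * D ^ (n - 1)].  If [S] were infinite, the Vandermonde
    determinant of a large Galois-stable finite subset of [S] would be too small
    when expressed through powers of [T], and too large when expressed through
    powers of an iterate of [g], because there its square is a nonzero integer. *)
Require Import Defs.
From HB Require Import structures.
From mathcomp Require Import all_boot all_order all_algebra.
From mathcomp Require Import perm separable algC algnum finmap.
From mathcomp Require Import boolp classical_sets functions cardinality reals.
From mathcomp Require Import complex.
From mathcomp Require Import zify ring lra.

Set Implicit Arguments.
Unset Strict Implicit.
Unset Printing Implicit Defensive.

Import Order.TTheory GRing.Theory Num.Theory.

Local Open Scope classical_set_scope.
Local Open Scope card_scope.
Local Open Scope ring_scope.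

(** * Vandermonde determinants *)

(** The evaluation matrix is the matrix of coefficients of the [b k], lower triangular by the size
    hypothesis, times the Vandermonde matrix. This allows one determinant to be read through
    different polynomial bases. *)
Lemma det_horner_trig (K : comNzRingType) (N : nat) (b : nat -> {poly K})
    (x : 'rV[K]_N) :
  (forall k, (size (b k) <= k.+1)%N) ->
  \det (\matrix_(k < N, s < N) (b k).[x 0 s]) =
    (\prod_(k < N) (b k)`_k) * \det (Vandermonde N x).
Proof.
move=> sz; pose L : 'M[K]_N := \matrix_(k < N, i < N) (b k)`_i.
have -> : \matrix_(k < N, s < N) (b k).[x 0 s] = L *m Vandermonde N x.
  apply/matrixP => k s; rewrite !mxE (horner_coef_wide _ (leq_trans (sz k) (ltn_ord k))).
  by apply: eq_bigr => i _; rewrite !mxE.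
rewrite det_mulmx det_trig; first by under eq_bigr do rewrite mxE.
by apply/is_trig_mxP => i j ij; rewrite mxE nth_default // (leq_trans (sz i)).
Qed.

(** The Leibniz formula gives the crude factor [N!], which is harmless because the gain it competes
    with is exponential in the square of [N]. *)
Lemma ler_norm_det (C : numDomainType) (N : nat) (A : 'M[C]_N) (c : nat -> C) :
  (forall i j, `|A i j| <= c i) -> `|\det A| <= N`!%:R * \prod_(i < N) c i.
Proof.
move=> Ac; rewrite /determinant (le_trans (ler_norm_sum _ _ _)) //.
apply: (@le_trans _ _ (\sum_(s : 'S_N) \prod_(i < N) c i)).
  apply: ler_sum => s _; rewrite normrM normr_sign mul1r normr_prod.
  by apply: ler_prod => i _; rewrite normr_ge0 Ac.
by rewrite sumr_const mulr_natl -(card_Sn N).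
Qed.

Lemma det_Vandermonde_neq0 (K : idomainType) (s : seq K) :
  uniq s -> \det (Vandermonde (size s) (\row_i s`_i)) != 0.
Proof.
move=> us; rewrite det_Vandermonde; apply/prodf_neq0 => i _.
apply/prodf_neq0 => j ij; rewrite !mxE subr_eq0 nth_uniq //.
by rewrite eq_sym neq_ltn ij.
Qed.

(* Reduction of ['X^k * 'X^i] modulo [p] is a rational matrix which the
   Vandermonde matrix diagonalizes, so the power sums of the roots are traces. *)
Lemma power_sum_rational (F : fieldType) (K : fieldType)
    (phi : {rmorphism F -> K}) (p : {poly F}) (s : seq K) (k : nat) :
  uniq s -> map_poly phi p = \prod_(z <- s) ('X - z%:P) ->
  exists q : F, \sum_(z <- s) z ^+ k = phi q.
Proof.
move=> us ps; set N := size s.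
pose x : 'rV[K]_N := \row_i s`_i.
pose V := Vandermonde N x.
have V0 : V \in unitmx by rewrite unitmxE unitfE det_Vandermonde_neq0.
have szp : size p = N.+1.
  by rewrite -(size_map_poly phi) ps size_prod_XsubC.
pose A : 'M[F]_N := \matrix_(i, j) ('X^(i + k) %% p)`_j.
pose D : 'rV[K]_N := \row_i s`_i ^+ k.
have AV : map_mx phi A *m V = V *m diag_mx D.
  apply/matrixP => i j; rewrite mul_mx_diag !mxE -exprD.
  have rt : root (map_poly phi p) s`_j.
    by rewrite ps root_prod_XsubC mem_nth.
  transitivity ((map_poly phi ('X^(i + k) %% p)).[s`_j]).
    rewrite (@horner_coef_wide _ N).
      by apply: eq_bigr => l _; rewrite !mxE coef_map.
    rewrite size_map_poly -ltnS -szp ltn_modp -size_poly_gt0.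
    by rewrite szp.
  have /(congr1 (fun r => (map_poly phi r).[s`_j])) := divp_eq 'X^(i + k) p.
  rewrite rmorphD rmorphM /= hornerD hornerM (rootP rt) mulr0 add0r.
  by rewrite map_polyXn hornerXn => <-.
exists (\tr A); rewrite (big_nth 0) big_mkord.
transitivity (\tr (diag_mx D)).
  by rewrite mxtrace_diag; apply: eq_bigr => i _; rewrite mxE.
rewrite -[diag_mx D](mulKmx V0) -AV mulmxA -mxtrace_mulC mulmxA mulmxV //.
by rewrite mul1mx /mxtrace rmorph_sum; apply: eq_bigr => i _; rewrite mxE.
Qed.

(** The Vandermonde matrix times its transpose is the Hankel matrix of the power sums of the
    roots. *)
Lemma sqr_det_Vandermonde_rational (F : fieldType) (K : fieldType)
    (phi : {rmorphism F -> K}) (p : {poly F}) (s : seq K) :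
  uniq s -> map_poly phi p = \prod_(z <- s) ('X - z%:P) ->
  exists q : F, \det (Vandermonde (size s) (\row_i s`_i)) ^+ 2 = phi q.
Proof.
move=> us ps; set V := Vandermonde _ _.
have /choice[t tE] k := power_sum_rational k us ps.
exists (\det (\matrix_(i < size s, j < size s) t (i + j)%N)).
rewrite expr2 -{2}det_tr -det_mulmx -det_map_mx; congr (\det _).
apply/matrixP => i j; rewrite !mxE -tE (big_nth 0) big_mkord.
by apply: eq_bigr => l _; rewrite !mxE exprD.
Qed.

(** * Growth estimates and algebraic integers *)

(** Squaring Bernoulli's inequality yields quadratic growth in [i], enough to beat any linear
    function. *)
Lemma bernoulli_sqr (F : realFieldType) (rho : F) (i j : nat) :
  1 < rho -> (2 * i <= j)%N -> ((rho - 1) * i%:R) ^+ 2 <= rho ^+ j.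
Proof.
move=> rho1 ij; have r0 : 0 <= rho by lra.
have bern n : 1 + (rho - 1) * n%:R <= rho ^+ n.
  elim: n => [|n IH]; first by rewrite expr0; lra.
  rewrite exprSr -natr1; apply: (@le_trans _ _ ((1 + (rho - 1) * n%:R) * rho)); last exact: ler_wpM2r.
  have : 0 <= (rho - 1) ^+ 2 * n%:R by rewrite mulr_ge0 ?sqr_ge0.
  by lra.
apply: (@le_trans _ _ (rho ^+ (2 * i))); last by apply: ler_weXn2l => //; lra.
have p0 : 0 <= (rho - 1) * i%:R by rewrite mulr_ge0 ?ler0n//; lra.
rewrite mulnC exprM lerXn2r ?nnegrE ?exprn_ge0 //.
by apply: le_trans (bern i); lra.
Qed.

Lemma exp_quotient_dominates_linear (F : archiRealFieldType) (rho A : F) (M : nat) :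
  1 < rho -> 0 <= A -> (0 < M)%N ->
  exists K, forall k, (K <= k)%N -> A * k.+1%:R <= rho ^+ (k %/ M).
Proof.
move=> rho1 A0 M0; set e := rho - 1; have e0 : 0 < e by rewrite /e; lra.
(* With [i = k %/ (2 * M)], the claim reduces to [A * (4 * M * i) <= (e * i) ^+ 2], which holds as
   soon as [i] exceeds [4 * M * A / e ^+ 2]. *)
pose i0 := (Num.bound (4 * M%:R * A / e ^+ 2)).+1.
exists (2 * M * i0)%N => k Kk.
set i := (k %/ (2 * M))%N.
have i0i : (i0 <= i)%N by rewrite leq_divRL ?muln_gt0 // mulnC.
have ij : (2 * i <= k %/ M)%N.
  by rewrite /i mulnC [(2 * M)%N]mulnC divnMA leq_trunc_div.
apply: le_trans (bernoulli_sqr rho1 ij); rewrite -/e.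
have k4 : (k.+1 <= 4 * M * i)%N.
  have i1 : (0 < i)%N by apply: leq_trans i0i.
  have := ltn_ceil k (_ : 0 < 2 * M)%N; rewrite muln_gt0 /= => /(_ M0).
  rewrite -/i => /leq_trans; apply.
  have : (0 < M * i)%N by rewrite muln_gt0 M0.
  nia.
apply: (@le_trans _ _ (A * (4 * M * i)%:R)).
  by rewrite ler_wpM2l // ler_nat.
rewrite !natrM exprMn [i%:R ^+ 2]expr2 !mulrA ler_wpM2r //.
have : 4 * M%:R * A / e ^+ 2 <= i%:R.
  apply: le_trans (ltW (archi_boundP _)) _.
    by rewrite divr_ge0 ?mulr_ge0 ?exprn_ge0 // ltW.
  by rewrite ler_nat (leq_trans _ i0i).
by rewrite ler_pdivrMr ?exprn_gt0 //; lra.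
Qed.

(** Passing from [k] to [k.+1] multiplies the left side by [A * k.+1] and the right side by
    [rho ^+ (k %/ M)], eventually at least twice as much. The spare powers of 2 then overtake the
    constant accumulated before that point. *)
Lemma exp_quadratic_dominates_fact (F : archiRealFieldType) (rho A : F) (M : nat) :
  1 < rho -> 0 < A -> (0 < M)%N ->
  exists N0, forall N, (N0 <= N)%N ->
    N`!%:R * A ^+ N < rho ^+ (\sum_(k < N) k %/ M).
Proof.
move=> rho1 A0 M0; have rho0 : 0 < rho by lra.
have [|||K HK] := @exp_quotient_dominates_linear _ rho (2 * A) M => //; first by lra.
pose c := K`!%:R * A ^+ K.
have c0 : 0 < c by rewrite mulr_gt0 ?exprn_gt0 // ltr0n fact_gt0.
have key n : (K + n)`!%:R * A ^+ (K + n) * 2 ^+ n <=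
    c * rho ^+ (\sum_(k < K + n) k %/ M).
  elim: n => [|n IH].
    by rewrite addn0 expr0 mulr1 ler_peMr ?(ltW c0) // exprn_ege1 // ltW.
  rewrite addnS factS natrM big_ord_recr /= exprD !exprS.
  have /= := ler_pM _ _ IH (HK (K + n)%N (leq_addr _ _)).
  rewrite !mulr_ge0 ?exprn_ge0 ?ler0n ?(ltW A0) // => /(_ isT isT).
  by move=> h; apply: (le_trans _ (le_trans h _)); lra.
pose n0 := Num.bound c.
exists (K + n0)%N => N KN; have KN' : (K <= N)%N by apply: leq_trans KN; rewrite leq_addr.
have := key (N - K)%N; rewrite subnKC // => kN.
have c2 : c < 2 ^+ (N - K).
  apply: lt_le_trans (archi_boundP (ltW c0)) _.
  rewrite -/n0 -natrX ler_nat (leq_trans _ (ltnW (ltn_expl _ _))) //.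
  by rewrite leq_subRL.
have r0 : 0 < rho ^+ (\sum_(k < N) k %/ M) by rewrite exprn_gt0.
rewrite -(ltr_pM2r (_ : 0 < 2 ^+ (N - K))) ?exprn_gt0 //.
by apply: le_lt_trans kN _; rewrite mulrC ltr_pM2l.
Qed.

Lemma rat_integral_int (K : numFieldType) (q : rat) :
  integralOver (intr : int -> K) (ratr q) -> exists z : int, q = z%:~R.
Proof.
case=> p pm; rewrite -[map_poly _ p](_ : map_poly ratr (map_poly intr p) = _); last first.
  by rewrite -map_poly_comp; apply: eq_map_poly => b /=; rewrite rmorph_int.
rewrite fmorph_root => pq.
have /intrP[z zE] : (ratr q : algC) \is a Num.int.
  apply: Cint_rat_Aint; first exact: Crat_rat.
  apply: (@root_monic_Aint (map_poly intr p)).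
  - rewrite -[map_poly _ p](_ : map_poly ratr (map_poly intr p) = _); last first.
      by rewrite -map_poly_comp; apply: eq_map_poly => b /=; rewrite rmorph_int.
    by rewrite fmorph_root.
  - by apply: monic_map.
  - by apply/polyOverP => i; rewrite coef_map /= rpred_int_num.
exists z; apply: (fmorph_inj (@ratr algC)).
by rewrite [LHS]zE [RHS]rmorph_int.
Qed.

Lemma rat_integral_norm_ge1 (K : numFieldType) (q : rat) :
  integralOver (intr : int -> K) (ratr q) -> q != 0 -> 1 <= `|q|.
Proof.
move=> /rat_integral_int[z ->]; rewrite intr_eq0 => z0.
by rewrite -intr_norm -[1]/(1%:~R) ler_int -gtz0_ge1 normr_gt0.
Qed.

Lemma integral_exp (R K : comNzRingType) (f : {rmorphism R -> K}) (x : K) n :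
  integralOver f x -> integralOver f (x ^+ n).
Proof.
move=> ix; elim: n => [|n IH]; first exact: integral1.
by rewrite exprS; apply: integral_mul.
Qed.

Lemma integral_det (R K : comNzRingType) (f : {rmorphism R -> K}) n (A : 'M[K]_n) :
  (forall i j, integralOver f (A i j)) -> integralOver f (\det A).
Proof.
move=> iA; apply: (big_ind (integralOver f)) => [||s _].
- exact: integral0.
- by move=> x y; apply: integral_add.
apply: integral_mul; first by apply: integral_exp; apply: integral_opp; apply: integral1.
apply: (big_ind (integralOver f)) => //; first exact: integral1.
by move=> x y; apply: integral_mul.
Qed.

(** * Finiteness of Galois-stable sets of small capacity *)

(** If the quotient [s] did not vanish at [z], then [z] would be a root of the gcd [w] of some
    multiplicity [k.+1]. As [w] divides the derivative of [s * w], it would divide [s] times its own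
    derivative, where [z] has multiplicity only [k] in characteristic 0. *)
Lemma root_squarefree_part (K : numFieldType) (p : {poly K}) (z : K) :
  p != 0 -> root p z -> root (p %/ gcdp p p^`()) z.
Proof.
move=> p0 pz; set w := gcdp p p^`(); set s := p %/ w.
have psw : p = s * w by rewrite divpK // dvdp_gcdl.
have w0 : w != 0 by rewrite gcdp_eq0 negb_and p0.
apply/negPn/negP => sz.
have [[|k] [v /implyP/(_ w0) vz wE]] := multiplicity_XsubC w z.
  by move: pz; rewrite psw rootM (negPf sz) wE expr0 mulr1 (negPf vz).
have : w %| p^`() by rewrite dvdp_gcdr.
rewrite psw derivM (dvdp_addr _ (dvdp_mull _ (dvdpp w))) wE derivM deriv_exp derivXsubC mul1r.
rewrite -[_ *+ k.+1]mulr_natl /= exprSr.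
have -> : s * (v^`() * (('X - z%:P) ^+ k * ('X - z%:P)) + v * (k.+1%:R * ('X - z%:P) ^+ k)) =
    ('X - z%:P) ^+ k * (s * (v^`() * ('X - z%:P) + v * k.+1%:R)) by ring.
rewrite mulrCA dvdp_mul2l ?expf_neq0 ?polyXsubC_eq0 // => /(dvdp_trans (dvdp_mull v (dvdpp _))).
rewrite dvdp_XsubCl rootM (negPf sz) /= rootE !hornerE subrr mulr0 add0r.
rewrite mulf_eq0 -rootE (negPf vz) /= -[k.+1%:R]/(k.+1%:R) hornerMn hornerC.
by rewrite pnatr_eq0.
Qed.

(* [S] consists of algebraic numbers and contains all their conjugates. *)
Definition galois_stable (C : numClosedFieldType) (S : set C) :=
  forall x, S x -> exists q : {poly rat},
    [/\ q != 0, root (map_poly ratr q) x & forall z, root (map_poly ratr q) z -> S z].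

(** Multiply the rational polynomials attached to [N] points of [S]; the monic squarefree part of
    the product has simple roots, all in [S], and still vanishes at the chosen points. *)
Lemma galois_stable_seq (C : numClosedFieldType) (S : set C) (N : nat) :
  galois_stable S -> infinite_set S ->
  exists (p : {poly rat}) (s : seq C),
    [/\ uniq s, forall z, z \in s -> S z, (N <= size s)%N &
        map_poly ratr p = \prod_(z <- s) ('X - z%:P)].
Proof.
move=> gS /(@infinite_set_fset _ _ N)[B BS NB].
have [p [p0 pB pS]] : exists p : {poly rat}, [/\ p != 0,
    {in enum_fset B, forall x, root (map_poly ratr p) x} &
    forall z, root (map_poly ratr p) z -> S z].
  have : forall x, x \in enum_fset B -> S x by move=> x xB; apply: BS.
  elim: (enum_fset B) => [|x l IH] lS.
    by exists 1; split=> [||z]; rewrite ?oner_eq0 // rmorph1 (negPf (root1 z)).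
  have [p [p0 pl pS]] : _ := IH (fun y yl => lS y (mem_behead (s := x :: l) yl)).
  have [q [q0 qx qS]] := gS x (lS x (mem_head _ _)).
  exists (q * p); rewrite mulf_neq0 // rmorphM /=; split=> // [y|z].
    by rewrite inE rootM => /predU1P[->|/pl ->]; rewrite ?qx ?orbT.
  by rewrite rootM => /orP[/qS|/pS].
pose r := p %/ gcdp p p^`().
have rp : r %| p by rewrite -[X in _ %| X](divpK (dvdp_gcdl p p^`())) dvdp_mulr.
have r0 : r != 0 by apply: contraNneq p0 => r0; move: rp; rewrite r0 dvd0p.
have sr : separable_poly r by apply: make_separable.
pose rm := (lead_coef r)^-1 *: r.
have lr0 : (lead_coef r)^-1 != 0 by rewrite invr_eq0 lead_coef_eq0.
have [s sE] := closed_field_poly_normal (map_poly (@ratr C) rm).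
have lrm : lead_coef (map_poly (@ratr C) rm) = 1.
  by rewrite lead_coef_map lead_coefZ mulVf ?rmorph1 // lead_coef_eq0.
rewrite lrm scale1r in sE.
have rootrm (z : C) : root (map_poly ratr rm) z = root (map_poly ratr r) z.
  by rewrite /rm map_polyZ rootZ // fmorph_eq0.
exists rm, s; split=> //.
- rewrite -separable_prod_XsubC -sE separable_map.
  by rewrite (eqp_separable (eqp_scale _ lr0)).
- move=> z; rewrite -root_prod_XsubC -sE rootrm => rz; apply: pS.
  by move: rz; rewrite -!dvdp_XsubCl => /dvdp_trans; apply; rewrite dvdp_map.
- apply: leq_trans NB _; apply: uniq_leq_size; first exact: fset_uniq.
  move=> z /pB pz; rewrite -root_prod_XsubC -sE rootrm /r map_divp gcdp_map -deriv_map.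
  by apply: root_squarefree_part; rewrite ?map_poly_eq0.
Qed.

(** A triangular basis: one polynomial of degree at most [k] for each [k], built from powers of [P]
    of degree [M], with the remainder modulo [M] filled by powers of [c *: 'X]. The scalar [c]
    serves to clear denominators. *)
Definition block_poly (K : idomainType) (M : nat) (P : {poly K}) (c : K) (k : nat) :
  {poly K} := (c *: 'X) ^+ (k %% M) * P ^+ (k %/ M).

Lemma size_coef_block_poly (K : idomainType) (M : nat) (P : {poly K}) (c : K) (k : nat) :
  size P = M.+1 ->
  (size (block_poly M P c k) <= k.+1)%N /\
  (block_poly M P c k)`_k = c ^+ (k %% M) * lead_coef P ^+ (k %/ M).
Proof.
move=> szP; have P0 : P != 0 by rewrite -size_poly_gt0 szP.
have szPk : size (P ^+ (k %/ M)) = (k %/ M * M).+1.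
  by rewrite -[LHS]prednK ?size_poly_gt0 ?expf_neq0 // size_exp szP mulnC.
rewrite /block_poly exprZn -scalerAl -commr_polyXn; split.
  apply: leq_trans (size_scale_leq _ _) _.
  by rewrite size_mulXn ?expf_neq0 // szPk addnS addnC -divn_eq.
rewrite coefZ coefMXn [in (k < _)%N]ltnNge leq_mod /=; congr (_ * _).
rewrite -lead_coef_exp lead_coefE szPk /=; congr (_ `_ _).
by rewrite {1}(divn_eq k M) addnK.
Qed.

Lemma det_block_poly (K : idomainType) (M N : nat) (P : {poly K}) (c : K) (x : 'rV[K]_N) :
  size P = M.+1 ->
  \det (\matrix_(k < N, s < N) (block_poly M P c k).[x 0 s]) =
    c ^+ (\sum_(k < N) k %% M) * lead_coef P ^+ (\sum_(k < N) k %/ M) *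
    \det (Vandermonde N x).
Proof.
move=> szP; rewrite det_horner_trig => [|k]; last by case: (size_coef_block_poly c k szP).
congr (_ * _); rewrite !expr_sum -big_split.
by apply: eq_bigr => k _; case: (size_coef_block_poly c k szP).
Qed.

(** On an infinite [S], the Vandermonde determinant of [N] conjugate-closed points is bounded above
    through the basis built on [P1] and below through the one built on [P2]. The ratio of the two
    leading terms enters with an exponent quadratic in [N], against losses of size [N!] times an
    [N]-th power. *)
Lemma galois_stable_finite (C : numClosedFieldType) (S : set C)
    (P1 P2 : {poly rat}) (M : nat) (t : int) (A q : rat) :
  galois_stable S -> (0 < M)%N -> size P1 = M.+1 -> size P2 = M.+1 ->
  t != 0 -> 1 <= A -> 0 < q ->
  (forall z, S z -> `|z| <= ratr A) ->
  (forall z, S z -> `|(map_poly ratr P1).[z]| <= ratr q) ->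
  (forall z, S z -> integralOver (intr : int -> C) (t%:~R * z)) ->
  (forall z, S z -> integralOver (intr : int -> C) (map_poly ratr P2).[z]) ->
  q * `|lead_coef P2| < `|lead_coef P1| ->
  finite_set S.
Proof.
move=> gS M0 sz1 sz2 t0 A1 q0 SA SP1 St SP2 lc12.
have [//|infS] := pselect (finite_set S).
have l2 : 0 < `|lead_coef P2|.
  by rewrite normr_gt0 lead_coef_eq0 -size_poly_gt0 sz2.
pose rho := `|lead_coef P1| / (q * `|lead_coef P2|).
have rho1 : 1 < rho by rewrite ltr_pdivlMr ?mulr_gt0 // mul1r.
(* The remainders [k %% M] sum to at most [M * N], so [A] and [t] together cost at most [B ^+ N]. *)
pose B : rat := (A * `|t%:~R|) ^+ M.
have t1 : 1 <= `|t%:~R : rat|.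
  by rewrite -intr_norm -[1]/(1%:~R) ler_int -gtz0_ge1 normr_gt0.
have At1 : 1 <= A * `|t%:~R| by rewrite -[1]mulr1 ler_pM.
have B0 : 0 < B by rewrite exprn_gt0 // (lt_le_trans ltr01).
have [N0 HN] := exp_quadratic_dominates_fact rho1 B0 M0.
have [p [s [us sS /HN{HN} + sE]]] := galois_stable_seq N0 gS infS.
set N := size s => HN; pose x : 'rV[C]_N := \row_i s`_i.
have Sx i : S (x 0 i) by rewrite mxE; apply: sS; rewrite mem_nth.
pose V := \det (Vandermonde N x).
have V0 : V != 0 by apply: det_Vandermonde_neq0.
have [v vE] := sqr_det_Vandermonde_rational us sE.
set sg := (\sum_(k < N) k %/ M)%N in HN.
pose sg' := (\sum_(k < N) k %% M)%N.
have szm (P : {poly rat}) : size (map_poly (@ratr C) P) = size P by rewrite size_map_poly.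
have dE (P : {poly rat}) (c : int) : size P = M.+1 ->
  \det (\matrix_(k < N, j < N) (block_poly M (map_poly ratr P) c%:~R k).[x 0 j]) =
  ratr (c%:~R ^+ sg' * lead_coef P ^+ sg) * V.
  move=> szP; rewrite det_block_poly ?szm // lead_coef_map.
  by rewrite rmorphM !rmorphXn /= rmorph_int.
have hE (P : {poly C}) c k z : (block_poly M P c k).[z] = (c * z) ^+ (k %% M) * P.[z] ^+ (k %/ M).
  by rewrite /block_poly !hornerE.
(* The block determinant [W] is an algebraic integer, and its square is a nonzero rational, hence a
   nonzero integer. *)
have low : 1 <= `|ratr (t%:~R ^+ sg' * lead_coef P2 ^+ sg) * V|.
  rewrite -dE //; set W := \det _.
  have iW : integralOver (intr : int -> C) W.
    apply: integral_det => i j; rewrite mxE hE.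
    by apply: integral_mul; apply: integral_exp; [apply: St|apply: SP2].
  set c := t%:~R ^+ sg' * lead_coef P2 ^+ sg.
  have WE : W ^+ 2 = ratr (c ^+ 2 * v).
    by rewrite /W dE // exprMn -/c -[V ^+ 2]/(_ ^+ 2) vE [RHS]rmorphM [in RHS]rmorphXn.
  have c0 : c ^+ 2 * v != 0.
    rewrite -(fmorph_eq0 (@ratr C)) /= -WE expf_neq0 // /W dE // mulf_neq0 //.
    rewrite fmorph_eq0 mulf_neq0 //; first by rewrite expf_neq0 ?intr_eq0.
    by rewrite expf_neq0 // -normr_gt0.
  have : 1 <= `|W| ^+ 2.
    rewrite -normrX WE -ratr_norm -(rmorph1 (@ratr C)) ler_rat /=.
    by apply: (@rat_integral_norm_ge1 C) => //; rewrite -WE; apply: integral_exp.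
  by rewrite expr_ge1.
have up : `|ratr (1%:~R ^+ sg' * lead_coef P1 ^+ sg) * V| <=
    N`!%:R * ratr (A ^+ sg' * q ^+ sg).
  rewrite -dE //.
  have := @ler_norm_det C N (\matrix_(k < N, j < N) (block_poly M (map_poly ratr P1) 1%:~R k).[x 0 j])
    (fun k => ratr A ^+ (k %% M) * ratr q ^+ (k %/ M)).
  rewrite big_split /= -!expr_sum -!rmorphXn -rmorphM; apply => i j.
  rewrite mxE hE mul1r normrM !normrX.
  by apply: ler_pM; rewrite ?exprn_ge0 // lerXn2r ?nnegrE ?(le_trans _ (SA _ (Sx j))) ?(le_trans _ (SP1 _ (Sx j))) ?SA ?SP1.
rewrite expr1n mul1r in up.
have main : `|lead_coef P1| ^+ sg <= N`!%:R * (A ^+ sg' * q ^+ sg) *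
    (`|t%:~R| ^+ sg' * `|lead_coef P2| ^+ sg).
  rewrite -(ler_rat C) !rmorphM /= rmorph_nat.
  rewrite normrM -ratr_norm normrM !normrX in low.
  rewrite normrM -ratr_norm normrX in up.
  set c1 := ratr (`|lead_coef P1| ^+ sg) in up *.
  have c10 : 0 <= c1 by rewrite -(rmorph0 (@ratr C)) ler_rat exprn_ge0.
  rewrite -[X in X <= _]mulr1; apply: le_trans (ler_wpM2l c10 low) _.
  rewrite [ratr (A ^+ _ * _)]rmorphM /= in up.
  rewrite [ratr (_ * _)]rmorphM /= mulrCA [_ * (c1 * _)]mulrC.
  by apply: ler_wpM2r up; rewrite mulr_ge0 // -(rmorph0 (@ratr C)) ler_rat exprn_ge0.
have sgM : (sg' <= M * N)%N.
  rewrite mulnC -[N in (N * M)%N]card_ord -sum_nat_const.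
  by apply: leq_sum => i _; rewrite ltnW // ltn_mod.
suff : rho ^+ sg <= N`!%:R * B ^+ N by rewrite leNgt HN.
have lq : 0 < q * `|lead_coef P2| by rewrite mulr_gt0.
rewrite /rho expr_div_n ler_pdivrMr ?exprn_gt0 //.
apply: le_trans main _.
rewrite /B -exprM [(q * _) ^+ sg]exprMn.
apply: (@le_trans _ _ (N`!%:R * (A * `|t%:~R|) ^+ sg' * (q ^+ sg * `|lead_coef P2| ^+ sg))).
  by rewrite exprMn; lra.
rewrite ler_wpM2r ?mulr_ge0 ?exprn_ge0 ?(ltW q0) //.
by rewrite ler_wpM2l // ler_weXn2l.
Qed.

(** * Preperiodic points *)

Lemma preperiodicP (K : fieldType) (f : {poly K}) (a : K) :
  preperiodic f a <->
  exists m n, (m < n)%N /\ iter n (horner f) a = iter m (horner f) a.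
Proof.
split=> [fin|[m [n [mn E]]]].
  apply: contrapT => nE; apply: infinite_nat.
  have inj : injective (fun n => iter n (horner f) a).
    move=> i j ij; apply/eqP; case: (ltngtP i j) => // lij; exfalso; apply: nE.
      by exists i, j.
    by exists j, i.
  apply: sub_finite_set (finite_preimage (in2W inj) fin) => i _ /=.
  by exists i.
apply: (@sub_finite_set _ _ [set` [seq iter k (horner f) a | k <- iota 0 n]]) => //.
move=> _ [k _ <-] /=; elim/ltn_ind: k => k IH.
have [kn|nk] := ltnP k n; first by apply: map_f; rewrite mem_iota.
rewrite -(subnK nk) iterD E -iterD; apply: IH.
by rewrite -{2}(subnK nk) ltn_add2l.
Qed.

Lemma preperiodic_iter (K : fieldType) (f : {poly K}) (a : K) n :
  preperiodic f a -> preperiodic f (iter n (horner f) a).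
Proof.
by apply: sub_finite_set => _ [k _ <-]; exists (k + n)%N; rewrite // iterD.
Qed.

Definition iter_poly (K : nzRingType) (f : {poly K}) (n : nat) : {poly K} :=
  iter n (fun p => f \Po p) 'X.

Lemma horner_iter_poly (K : comNzRingType) (f : {poly K}) n z :
  (iter_poly f n).[z] = iter n (horner f) z.
Proof. by elim: n => [|n IH] /=; rewrite ?hornerX // horner_comp IH. Qed.

Lemma map_iter_poly (K L : nzRingType) (phi : {rmorphism K -> L}) (f : {poly K}) n :
  map_poly phi (iter_poly f n) = iter_poly (map_poly phi f) n.
Proof. by elim: n => [|n IH] /=; rewrite ?map_polyX // map_comp_poly IH. Qed.

Lemma size_iter_poly (K : idomainType) (f : {poly K}) n :
  (1 < size f)%N -> size (iter_poly f n) = ((size f).-1 ^ n).+1.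
Proof.
move=> f1; have f0 : (0 < (size f).-1)%N by rewrite -ltnS prednK // ltnW.
elim: n => [|n IH]; first by rewrite size_polyX expn0.
have h : (size (f \Po iter_poly f n)).-1 = ((size f).-1 ^ n.+1)%N.
  by rewrite size_comp_poly IH expnS.
rewrite /= -h prednK // lt0n; apply: contraTneq (_ : 0 < (size f).-1 ^ n.+1)%N => [s0|].
  by rewrite -h s0.
by rewrite expn_gt0 f0.
Qed.

(** Far from the origin the leading term dominates, so absolute values increase strictly along the
    orbit and no value can recur. *)
Lemma escape_radius (C : numFieldType) (f : {poly rat}) :
  (2 < size f)%N ->
  exists A : rat, 1 <= A /\
    forall z, preperiodic (map_poly (@ratr C) f) z -> `|z| <= ratr A.
Proof.
move=> szf; pose D := (size f).-1; pose a := lead_coef f.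
have a0 : 0 < `|a| by rewrite normr_gt0 lead_coef_eq0 -size_poly_gt0 ltnW // ltnW.
pose s : rat := \sum_(i < D) `|f`_i|.
have s0 : 0 <= s by apply: sumr_ge0.
(* Beyond this radius both [1 < |y|] and [s + 1 < |a| * |y|] hold, so the leading term exceeds the
   lower terms by more than [|y| ^+ D.-1]. *)
exists (1 + (s + 1) / `|a|); set A : rat := 1 + _.
have A1 : 1 <= A by rewrite lerDl divr_ge0 ?(ltW a0) // addr_ge0.
split=> // z pz; set F := map_poly ratr f in pz *.
have step (y : C) : ratr A < `|y| -> `|y| < `|F.[y]|.
  move=> Ay.
  have y1 : 1 < `|y|.
    by apply: le_lt_trans Ay; rewrite -(rmorph1 (@ratr C)) ler_rat.
  have y0 : 0 < `|y| by apply: lt_trans y1.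
  have big : ratr s + 1 < ratr `|a| * `|y|.
    rewrite mulrC -ltr_pdivrMr; last by rewrite -(rmorph0 (@ratr C)) ltr_rat.
    apply: le_lt_trans Ay; rewrite -(rmorph1 (@ratr C)) -rmorphD -fmorph_div ler_rat.
    by rewrite lerDr.
  have tail : `|\sum_(i < D) F`_i * y ^+ i| <= ratr s * `|y| ^+ D.-1.
    apply: le_trans (ler_norm_sum _ _ _) _; rewrite rmorph_sum mulr_suml.
    apply: ler_sum => i _; rewrite coef_map normrM normrX /= -ratr_norm.
    rewrite ler_wpM2l //; first by rewrite -(rmorph0 (@ratr C)) ler_rat.
    rewrite ler_weXn2l ?(ltW y1) // -ltnS prednK //.
    by rewrite (leq_ltn_trans _ (ltn_ord i)).
  have E : F.[y] = \sum_(i < D) F`_i * y ^+ i + ratr a * y ^+ D.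
    rewrite horner_coef size_map_poly -[size f](prednK (ltnW (ltnW szf))) big_ord_recr /=.
    by rewrite coef_map.
  have D2 : (1 < D)%N by rewrite /D -ltnS prednK // (ltnW (ltnW szf)).
  have : (ratr `|a| * `|y| - ratr s) * `|y| ^+ D.-1 <= `|F.[y]|.
    rewrite E [X in _ <= `|X|]addrC; apply: le_trans (lerB_normD _ _).
    rewrite mulrBl -mulrA -exprS prednK ?(ltnW D2) // normrM normrX ratr_norm.
    by rewrite lerD2l lerN2.
  apply: lt_le_trans; apply: (@le_lt_trans _ _ (`|y| ^+ D.-1)).
    by rewrite -{1}(expr1 `|y|) ler_weXn2l ?(ltW y1) // -ltnS prednK // ltnW.
  by rewrite ltr_pMl ?exprn_gt0 // ltrBrDl.
rewrite real_leNgt ?normr_real //; last by rewrite ger0_real // -(rmorph0 (@ratr C)) ler_rat (le_trans ler01).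
apply/negP => Az.
have grow n : ratr A < `|iter n (horner F) z|.
  by elim: n => [|n IH] //=; apply: lt_trans (step _ IH).
have mono m n : (m < n)%N -> `|iter m (horner F) z| < `|iter n (horner F) z|.
  elim: n => // n IH; rewrite ltnS leq_eqVlt => /predU1P[->|/IH h]; first exact: step.
  exact: lt_trans h (step _ _).
have [m [n [mn E]]] := (preperiodicP F z).1 pz.
by have := mono _ _ mn; rewrite E ltxx.
Qed.

(** A suitable power of [u] times [b k] is a monic integer polynomial in [b 0], of degree growing
    with [k]; a coincidence [b n = b m] then becomes a monic equation for [b 0]. *)
Lemma finite_orbit_integral (K : fieldType) (Q : {poly int}) (u : int) (b : nat -> K) :
  Q \is monic -> (2 < size Q)%N ->
  (forall n, u%:~R * b n.+1 = (map_poly intr Q).[b n]) ->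
  (exists m n, (m < n)%N /\ b n = b m) ->
  integralOver (intr : int -> K) (b 0%N).
Proof.
move=> Qm szQ bS [m [n [mn bnm]]]; pose D := (size Q).-1.
have szQE : size Q = D.+1 by rewrite prednK // (ltnW (ltnW szQ)).
have D1 : (1 < D)%N by rewrite -ltnS -szQE.
pose e n := iter n (fun k => (D * k).+1) 0%N.
have eS k : e k.+1 = (D * e k).+1 by [].
have /choice[P PE] : forall k, exists P : {poly int},
    [/\ P \is monic, size P = (D ^ k).+1 &
        (map_poly intr P).[b 0%N] = u%:~R ^+ e k * b k].
  elim=> [|k [P [Pm szP Pb]]].
    by exists 'X; rewrite monicX size_polyX expn0 map_polyX hornerX expr0 mul1r.
  (* These are the lower terms of [Q] homogenized by [u ^+ e k], so that substituting
     [u ^+ e k * b k] gives [u ^+ (D * e k)] times [Q] at [b k]. *)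
  pose L := \sum_(i < D) (Q`_i * u ^+ (e k * (D - i))) *: P ^+ i.
  have szPX i : size (P ^+ i) = (D ^ k * i).+1.
    by rewrite -[LHS]prednK ?size_poly_gt0 ?expf_neq0 ?monic_neq0 // size_exp szP.
  have szL : (size L < size (P ^+ D))%N.
    rewrite szPX ltnS; apply: leq_trans (size_sum _ _ _) _.
    apply/bigmax_leqP => i _; apply: leq_trans (size_scale_leq _ _) _.
    by rewrite szPX ltn_mul2l ltn_ord expn_gt0 (ltnW D1).
  exists (P ^+ D + L); split.
  - by rewrite monicE lead_coefDl // -monicE monic_exp.
  - by rewrite size_polyDl // szPX expnSr.
  have -> : P ^+ D + L = \sum_(i < D.+1) (Q`_i * u ^+ (e k * (D - i))) *: P ^+ i.
    rewrite big_ord_recr /= addrC subnn muln0 expr0 mulr1.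
    by rewrite -[D in Q`_D]/((size Q).-1) -lead_coefE (monicP Qm) scale1r.
  rewrite raddf_sum /= horner_sum exprS -mulrA [_ * b k.+1]mulrC mulrA bS mulrC.
  rewrite horner_coef size_map_poly_id0; last by rewrite (monicP Qm) rmorph1 oner_neq0.
  rewrite szQE mulr_sumr; apply: eq_bigr => i _.
  rewrite map_polyZ hornerZ rmorphXn horner_exp Pb coef_map rmorphM rmorphXn /=.
  rewrite exprMn -exprM [in RHS]mulrCA -mulrA; congr (_ * _).
  rewrite mulrA -exprD -mulnDr subnK; last by rewrite -ltnS.
  by rewrite mulnC.
have [Pnm szPn Pnb] := PE n; have [Pmm szPm Pmb] := PE m.
have emn : (e m <= e n)%N.
  rewrite -(subnK (ltnW mn)); elim: (n - m)%N => // k /leq_trans; apply.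
  by rewrite addSn eS leqW // leq_pmull // ltnW.
have sz : (size (u ^+ (e n - e m) *: P m) < size (P n))%N.
  apply: leq_ltn_trans (size_scale_leq _ _) _.
  by rewrite szPm szPn ltnS ltn_exp2l.
(* The power of [u] equalizes the exponents [e m] and [e n]; the difference stays monic because
   [P m] has smaller degree. *)
exists (P n - u ^+ (e n - e m) *: P m).
  by rewrite monicE lead_coefDl ?size_polyN // -monicE.
rewrite rootE raddfB /= hornerD hornerN map_polyZ hornerZ Pnb Pmb bnm.
by rewrite rmorphXn /= mulrA -exprD subnK // subrr.
Qed.

(** Clear denominators to get [p = a * f] with leading coefficient [t]. Multiplying [p] by
    [t ^+ D.-1] makes it monic in the variable [t * z]. *)
Lemma preperiodic_integral (K : numFieldType) (f : {poly rat}) :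
  (2 < size f)%N ->
  exists t : int, t != 0 /\ forall z : K, preperiodic (map_poly ratr f) z ->
    integralOver (intr : int -> K) (t%:~R * z).
Proof.
move=> szf; have [p [a a0 fE]] := rat_poly_scale f.
have szp : size p = size f.
  by rewrite fE size_scale ?invr_eq0 ?intr_eq0 // size_rat_int_poly.
pose D := (size p).-1; have szpE : size p = D.+1 by rewrite prednK // szp ltnW // ltnW.
have D1 : (1 < D)%N by rewrite -ltnS -szpE szp.
set t := lead_coef p; have t0 : t != 0 by rewrite lead_coef_eq0 -size_poly_gt0 szpE.
exists t; split=> // z pz; set F := map_poly ratr f in pz.
pose L : {poly int} := \sum_(i < D) (p`_i * t ^+ (D.-1 - i)) *: 'X^i.
have szL : (size L < size ('X^D : {poly int}))%N.
  rewrite size_polyXn ltnS; apply: leq_trans (size_sum _ _ _) _.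
  apply/bigmax_leqP => i _; apply: leq_trans (size_scale_leq _ _) _.
  by rewrite size_polyXn.
have Fa y : a%:~R * F.[y] = (map_poly intr p).[y] :> K.
  rewrite /F fE map_polyZ /= -map_poly_comp hornerZ fmorphV rmorph_int mulrA.
  rewrite mulfV ?intr_eq0 // mul1r; congr (_.[_]).
  by apply: eq_map_poly => k /=; rewrite rmorph_int.
apply: (@finite_orbit_integral _ ('X^D + L) (a * t ^+ D.-2)
  (fun n => t%:~R * iter n (horner F) z)).
- by rewrite monicE lead_coefDl // -monicE monicXn.
- by rewrite size_polyDl // size_polyXn.
- move=> n; set y := iter n _ _; rewrite [iter n.+1 _ _]/= -/y.
  rewrite rmorphM rmorphXn /= -mulrA [_ ^+ _ * _]mulrA -exprSr prednK; last by rewrite -ltnS prednK // ltnW.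
  rewrite mulrCA Fa horner_coef size_map_poly_id0; last by rewrite -/t intr_eq0.
  rewrite szpE big_ord_recr /= mulrDr addrC raddfD /= hornerD map_polyXn hornerXn.
  congr (_ + _).
    rewrite exprMn coef_map -[D in p`_D]/((size p).-1) -lead_coefE -/t /= mulrA -exprSr prednK //.
    by rewrite ltnW.
  rewrite raddf_sum /= horner_sum mulr_sumr; apply: eq_bigr => i _.
  rewrite map_polyZ hornerZ map_polyXn hornerXn coef_map rmorphM rmorphXn /= exprMn.
  have -> : t%:~R ^+ D.-1 = t%:~R ^+ (D.-1 - i) * t%:~R ^+ i :> K.
    by rewrite -exprD subnK // -ltnS prednK // ltnW.
  by rewrite mulrACA [_ * (p`_i)%:~R]mulrC.
- have [m [n [mn E]]] := (preperiodicP F z).1 pz.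
  by exists m, n; rewrite E.
Qed.

(** A coincidence of iterates is a rational polynomial equation, nonzero because the two iterates
    have different degrees; each of its roots is preperiodic as well. *)
Lemma galois_stable_PrePer (C : numClosedFieldType) (f : {poly rat}) :
  (2 < size f)%N -> galois_stable (PrePer (map_poly (@ratr C) f)).
Proof.
move=> szf x /preperiodicP[m [n [mn E]]].
have rootE z : root (map_poly ratr (iter_poly f n - iter_poly f m)) z =
    (iter n (horner (map_poly (@ratr C) f)) z == iter m (horner (map_poly (@ratr C) f)) z).
  by rewrite raddfB /= !map_iter_poly rootE hornerD hornerN !horner_iter_poly subr_eq0.
have f1 : (1 < size f)%N by apply: ltnW.
exists (iter_poly f n - iter_poly f m); split.
- rewrite subr_eq0; apply/eqP => /(congr1 (fun p : {poly rat} => size p)).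
  rewrite !size_iter_poly // => -[/eqP]; rewrite eqn_exp2l; last by rewrite -ltnS prednK // ltnW.
  by rewrite gtn_eqF.
- by rewrite rootE E.
- by move=> z; rewrite rootE => /eqP zE; apply/preperiodicP; exists m, n.
Qed.

Lemma galois_stableI (C : numClosedFieldType) (S T : set C) :
  galois_stable S -> galois_stable T -> galois_stable (S `&` T).
Proof.
move=> gS gT x [/gS[p [p0 px pS]] /gT[q [q0 qx qT]]].
exists (gcdp p q); split; first by rewrite gcdp_eq0 negb_and p0.
  by rewrite gcdp_map root_gcd px.
by move=> z; rewrite gcdp_map root_gcd => /andP[/pS ? /qT].
Qed.

(** * Leading coefficients of iterates *)

(** A leading coefficient relative to a formal degree [k]: [c] may be 0, so sums and products need
    no discussion of cancellation. *)
Definition has_top (K : nzRingType) (p : {poly K}) (k : nat) (c : K) : Prop :=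
  (size p <= k.+1)%N /\ p`_k = c.

Lemma has_topM (K : comNzRingType) (p q : {poly K}) k l c d :
  has_top p k c -> has_top q l d -> has_top (p * q) (k + l) (c * d).
Proof.
move=> [sp pc] [sq qd]; split.
  by apply: leq_trans (size_polyMleq _ _) _; lia.
rewrite coefM (bigD1 (inord k)) //= inordK ?ltnS ?leq_addr // addKn pc qd.
rewrite big1 ?addr0 // => i; rewrite -val_eqE /= inordK ?ltnS ?leq_addr // => ik.
case: (ltngtP i k) ik => // [ik|ki] _.
  by rewrite [q`__]nth_default ?mulr0 //; apply: leq_trans sq _; lia.
by rewrite [p`__]nth_default ?mul0r //; apply: leq_trans sp _.
Qed.

Lemma has_topX (K : comNzRingType) (p : {poly K}) k c n :
  has_top p k c -> has_top (p ^+ n) (k * n) (c ^+ n).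
Proof.
move=> pc; elim: n => [|n IH]; first by rewrite muln0 !expr0; split; rewrite ?size_polyC ?coefC //; case: eqP.
by rewrite mulnS !exprS; apply: has_topM.
Qed.

Lemma has_topZ (K : comNzRingType) a (p : {poly K}) k c :
  has_top p k c -> has_top (a *: p) k (a * c).
Proof. by move=> [sp pc]; split; rewrite ?coefZ ?pc // (leq_trans (size_scale_leq _ _)). Qed.

Lemma has_topD (K : nzRingType) (p q : {poly K}) k c d :
  has_top p k c -> has_top q k d -> has_top (p + q) k (c + d).
Proof.
move=> [sp pc] [sq qd]; split; last by rewrite coefD pc qd.
by apply: leq_trans (size_polyD _ _) _; rewrite geq_max sp.
Qed.

Lemma has_top_sum (K : comNzRingType) (I : finType) (p : I -> {poly K}) k (c : I -> K) :
  (forall i, has_top (p i) k (c i)) -> has_top (\sum_i p i) k (\sum_i c i).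
Proof.
move=> pc; split; last by rewrite coef_sum; apply: eq_bigr => i _; case: (pc i).
apply: leq_trans (size_sum _ _ _) _; apply/bigmax_leqP => i _; by case: (pc i).
Qed.

Lemma has_top0 (K : nzRingType) (p : {poly K}) k l c :
  has_top p k c -> (k < l)%N -> has_top p l 0.
Proof.
move=> [sp _] kl; split; first by apply: leq_trans sp _; rewrite ltnS ltnW.
by rewrite nth_default // (leq_trans sp).
Qed.

Lemma has_top_lead (K : nzRingType) (p : {poly K}) k c :
  has_top p k c -> c != 0 -> size p = k.+1 /\ lead_coef p = c.
Proof.
move=> [sp pc] c0; have szp : size p = k.+1.
  apply/eqP; rewrite eqn_leq sp /= ltnNge; apply: contra c0 => h.
  by rewrite -pc nth_default.
by rewrite lead_coefE szp.
Qed.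

(* The exponent [(D ^ n - 1) / (D - 1)] of the leading coefficient of a
   polynomial of degree [D] in that of its [n]-th iterate. *)
Fixpoint iter_exp (D n : nat) : nat :=
  if n is k.+1 then (D * iter_exp D k).+1 else 0.

Lemma iter_expE D n : (0 < D)%N -> (D.-1 * iter_exp D n = D ^ n - 1)%N.
Proof.
move=> D0; elim: n => [|n IH]; first by rewrite muln0.
have := expn_gt0 D n; rewrite D0 /= => h.
by rewrite /= expnS mulnS mulnCA IH; nia.
Qed.

Lemma has_top_iter_poly (K : idomainType) (f : {poly K}) n : (1 < size f)%N ->
  has_top (iter_poly f n) ((size f).-1 ^ n) (lead_coef f ^+ iter_exp (size f).-1 n).
Proof.
move=> f1; have sz m : size (iter_poly f m) = ((size f).-1 ^ m).+1 by apply: size_iter_poly.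
split; first by rewrite sz.
suff : lead_coef (iter_poly f n) = lead_coef f ^+ iter_exp (size f).-1 n.
  by rewrite lead_coefE sz.
have D0 : (0 < (size f).-1)%N by rewrite -ltnS prednK // ltnW.
elim: n => [|n IH]; first by rewrite lead_coefX expr0.
rewrite /= lead_coef_comp; last by rewrite sz ltnS expn_gt0 D0.
by rewrite IH -exprM mulnC exprS.
Qed.

(** Factor [U - W] out of each [U ^+ i - W ^+ i]. In the cofactor only [i = D], the degree of [f],
    reaches the top degree, through [D] products with the same top coefficient. *)
Lemma has_top_comp_sub (K : comNzRingType) (f U W : {poly K}) m k l c :
  (1 < size f)%N -> has_top U m l -> has_top W m l -> (0 < m)%N -> has_top (U - W) k c ->
  has_top ((f \Po U) - (f \Po W)) (k + m * (size f).-2)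
    (c * (lead_coef f * (l ^+ (size f).-2 *+ (size f).-1))).
Proof.
move=> f1 Ul Wl m0 UWc; set D := (size f).-1.
have szf : size f = D.+1 by rewrite prednK // ltnW.
have D0 : (0 < D)%N by rewrite -ltnS -szf.
pose Z := \sum_(i < D.+1) f`_i *: \sum_(j < i) U ^+ (i.-1 - j) * W ^+ j.
have -> : (f \Po U) - (f \Po W) = (U - W) * Z.
  rewrite !comp_polyE -sumrB szf mulr_sumr; apply: eq_bigr => i _.
  by rewrite -scalerBr subrXX scalerAr.
apply: has_topM UWc _; rewrite -/D /Z big_ord_recr /=.
have UW n j : (j < n)%N -> has_top (U ^+ (n.-1 - j) * W ^+ j) (m * n.-1) (l ^+ n.-1).
  move=> jn; have E : n.-1 = (n.-1 - j + j)%N by rewrite subnK //; lia.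
  by rewrite {2 3}E mulnDr exprD; apply: has_topM; apply: has_topX.
have top : has_top (f`_D *: \sum_(j < D) U ^+ (D.-1 - j) * W ^+ j) (m * D.-1)
    (lead_coef f * (l ^+ D.-1 *+ D)).
  rewrite lead_coefE -/D; apply: has_topZ.
  by rewrite -[D in _ *+ D]card_ord -sumr_const; apply: has_top_sum => j; apply: UW.
suff low : has_top (\sum_(i < D) f`_i *: \sum_(j < i) U ^+ (i.-1 - j) * W ^+ j) (m * D.-1) 0.
  by have := has_topD low top; rewrite add0r.
suff : has_top (\sum_(i < D) f`_i *: \sum_(j < i) U ^+ (i.-1 - j) * W ^+ j) (m * D.-1)
    (\sum_(i < D) 0) by rewrite [\sum_(i < D) 0]big1.
apply: has_top_sum => i.
suff : has_top (\sum_(j < i) U ^+ (i.-1 - j) * W ^+ j) (m * D.-1) 0.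
  by move=> /(has_topZ f`_i); rewrite mulr0.
case: i => -[|i] iD /=.
  by rewrite big_ord0; split; rewrite ?size_poly0 ?coef0.
have h : (m * i < m * D.-1)%N by rewrite ltn_mul2l m0 /=; lia.
have := has_top_sum (fun j : 'I_i.+1 => has_top0 (UW i.+1 j (ltn_ord j)) h).
by rewrite [X in has_top _ _ X]big1.
Qed.

(* Each iteration multiplies the leading coefficient of the difference by the
   extra factor [D], although the difference stays bounded on common
   preperiodic points. *)
Lemma has_top_iter_poly_sub (K : idomainType) (g : {poly K}) (c : K) n :
  (2 < size g)%N ->
  let D := (size g).-1 in
  has_top (iter_poly g n.+1 - iter_poly (g + c%:P) n.+1) (D ^ n.+1 - D)
    (- (c * (D ^ n)%:R * lead_coef g ^+ (D * iter_exp D n))).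
Proof.
move=> szg D; set h := g + c%:P.
have szc : (size c%:P < size g)%N.
  by apply: leq_ltn_trans (size_polyC_leq1 c) _; apply: ltnW.
have szh : size h = size g by rewrite size_polyDl.
have lh : lead_coef h = lead_coef g by rewrite lead_coefDl.
have g1 : (1 < size g)%N by apply: ltnW.
have D1 : (1 < D)%N by rewrite -ltnS prednK // ltnW.
have hP p : h \Po p = (g \Po p) + c%:P by rewrite comp_polyD comp_polyC.
elim: n => [|n IH].
  rewrite expn1 subnn muln0 expr0 mulr1 expn0 mulr1 /= !comp_polyXr.
  by rewrite opprD addNKr; split; rewrite ?coefN ?coefC // size_polyN size_polyC_leq1.
set G := iter_poly g n.+1 in IH *; set H := iter_poly h n.+1 in IH *.
have Gt := has_top_iter_poly n.+1 g1; rewrite -/G -/D in Gt.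
have Ht : has_top H (D ^ n.+1) (lead_coef g ^+ iter_exp D n.+1).
  by have := has_top_iter_poly n.+1 (_ : 1 < size h)%N; rewrite szh lh -/H; apply.
have m0 : (0 < D ^ n.+1)%N by rewrite expn_gt0 (ltnW D1).
have Dn : (D <= D ^ n.+1)%N by rewrite -{1}[D]expn1 leq_pexp2l // ltnW.
have := has_top_comp_sub g1 Gt Ht m0 IH; rewrite -/D.
have -> : (D ^ n.+1 - D + D ^ n.+1 * D.-1 = D ^ n.+2 - D)%N by rewrite [in RHS]expnS; nia.
have -> : iter_poly g n.+2 - iter_poly h n.+2 = ((g \Po G) - (g \Po H)) - c%:P.
  by rewrite [iter_poly h n.+2]hP opprD addrA.
move=> [sz cf]; split.
  apply: leq_trans (size_polyD _ _) _; rewrite geq_max sz size_polyN.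
  by rewrite (leq_trans (size_polyC_leq1 c)).
(* The constant [c] separating [h] from [g] lies in degree 0, hence below the top. *)
have pos : (0 < D ^ n.+2 - D)%N by rewrite subn_gt0 -{1}[D]expn1 ltn_exp2l.
rewrite coefB cf coefC [(_ == 0)%N]gtn_eqF // subr0 -exprM mulNr; congr (- _).
have -> : (D * iter_exp D n.+1 = D * iter_exp D n + 1 + iter_exp D n.+1 * D.-1)%N.
  by rewrite -{1}(prednK (ltnW D1)) /=; lia.
by rewrite !exprD expr1 expnSr natrM mulr_natr; ring.
Qed.

(** * Common preperiodic points of a polynomial and its translate *)

Lemma exists_exp2_gt (x : rat) : exists n, x < 2 ^+ n.
Proof.
exists (Num.bound `|x|); apply: le_lt_trans (ler_norm x) _.
apply: lt_trans (archi_boundP (normr_ge0 x)) _.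
by rewrite -natrX ltr_nat ltn_expl.
Qed.

Lemma finite_PrePer_shift (C : numClosedFieldType) (g : {poly rat}) (c : rat) :
  (2 < size g)%N -> c != 0 ->
  finite_set (PrePer (map_poly (@ratr C) g) `&` PrePer (map_poly (@ratr C) (g + c%:P))).
Proof.
move=> szg c0; set h := g + c%:P; pose D := (size g).-1.
have szgE : size g = D.+1 by rewrite prednK // ltnW // ltnW.
have D1 : (1 < D)%N by rewrite -ltnS -szgE.
have szh : size h = size g.
  by rewrite size_polyDl // (leq_ltn_trans (size_polyC_leq1 c)) // ltnW.
set S := _ `&` _.
have gS : galois_stable S.
  by apply: galois_stableI; apply: galois_stable_PrePer; rewrite ?szh.
have [A1 [A11 SA1]] := escape_radius C szg.
have szh2 : (2 < size h)%N by rewrite szh.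
have [A2 [A21 SA2]] := escape_radius C szh2.
have [t [t0 St]] := preperiodic_integral C szg.
pose A := A1 + A2.
have A0 : 0 < A by rewrite /A; lra.
have le1 : ratr A1 <= ratr A :> C by rewrite ler_rat /A; lra.
have le2 : ratr A2 <= ratr A :> C by rewrite ler_rat /A; lra.
pose a := lead_coef g; have a0 : a != 0 by rewrite lead_coef_eq0 -size_poly_gt0 szgE.
have na : 0 < `|a| by rewrite normr_gt0.
(* The factor [D ^ N] in the leading coefficient of [T] must beat the bound [2 * A] for [T] on [S],
   with a further factor 2 to spare. *)
have [n cn] : exists n, 2 * (2 * A) <= `|c| * (D ^ n.+1)%:R.
  have [n hn] := exists_exp2_gt (2 * (2 * A) / `|c|); exists n.
  rewrite [X in _ <= X]mulrC -ler_pdivrMr ?normr_gt0 //.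
  apply: le_trans (ltW hn) _; rewrite -natrX ler_nat.
  by rewrite (leq_trans (leq_pexp2l _ (leqnSn n))) // leq_exp2r.
set N := n.+1 in cn; pose e := iter_exp D; pose E := (D.-1 * e N)%N.
have EE : E = (D ^ N - 1)%N by rewrite /E iter_expE // ltnW.
have DN : (D <= D ^ N)%N by rewrite -{1}[D]expn1 leq_pexp2l // ltnW.
have E0 : (0 < E)%N by rewrite EE; lia.
(* The spare factor 2, raised to the power [D ^ r], has to absorb what remains of [t] and [a];
   neither exponent [E] nor [e N] depends on [r]. *)
have [r hr] := exists_exp2_gt (`|t%:~R| ^+ E / `|a| ^+ e N).
pose T := iter_poly g N.+1 - iter_poly h N.+1.
have Tt := has_top_iter_poly_sub c N szg; rewrite -/h -/T -/D -/a -/e /= in Tt.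
pose P1 := T ^+ (D ^ r); pose P2 := (t%:~R *: iter_poly g r.+1) ^+ E.
have DE : (D ^ N.+1 - D = D * E)%N by rewrite EE expnS mulnBr muln1.
pose M := (D * E * D ^ r)%N.
have [s1 l1] : size P1 = M.+1 /\ lead_coef P1 = (- (c * (D ^ N)%:R * a ^+ (D * e N))) ^+ (D ^ r).
  apply: has_top_lead; first by rewrite /M -DE; apply: has_topX.
  by rewrite expf_neq0 // oppr_eq0 !mulf_neq0 ?expf_neq0 // pnatr_eq0 -lt0n expn_gt0 ltnW.
have [s2 l2] : size P2 = M.+1 /\ lead_coef P2 = (t%:~R * a ^+ e r.+1) ^+ E.
  apply: has_top_lead; last by rewrite expf_neq0 // mulf_neq0 ?intr_eq0 ?expf_neq0.
  have -> : M = (D ^ r.+1 * E)%N by rewrite /M expnS mulnAC.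
  by apply: has_topX; apply: has_topZ; apply: has_top_iter_poly; apply: ltnW.
have Sg z k : S z -> preperiodic (map_poly ratr g) (iter k (horner (map_poly (@ratr C) g)) z).
  by case=> zg _; apply: preperiodic_iter.
have Sh z k : S z -> preperiodic (map_poly ratr h) (iter k (horner (map_poly (@ratr C) h)) z).
  by case=> _ zh; apply: preperiodic_iter.
have TE z : (map_poly (@ratr C) T).[z] =
    iter N.+1 (horner (map_poly ratr g)) z - iter N.+1 (horner (map_poly ratr h)) z.
  rewrite -!horner_iter_poly -!map_iter_poly -hornerN -hornerD.
  by congr (_.[_]); apply: rmorphB.
apply: (@galois_stable_finite C S P1 P2 M t A ((2 * A) ^+ (D ^ r))) => //.
- by rewrite /M muln_gt0 (muln_gt0 D) E0 expn_gt0 ltnW.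
- by rewrite /A; lra.
- by rewrite exprn_gt0 // mulr_gt0.
- by move=> z [zg _]; apply: le_trans (SA1 z zg) le1.
- move=> z Sz; rewrite /P1 rmorphXn hornerE normrX rmorphXn /= lerXn2r ?nnegrE //.
    by rewrite -(rmorph0 (@ratr C)) ler_rat mulr_ge0 // ltW.
  have -> : 2 * A = A + A by ring.
  rewrite TE [X in _ <= X]rmorphD; apply: le_trans (ler_normB _ _) (lerD _ _).
    by apply: le_trans le1; apply: SA1; apply: Sg.
  by apply: le_trans le2; apply: SA2; apply: Sh.
- by move=> z [zg _]; apply: St.
- move=> z Sz; rewrite /P2 rmorphXn hornerE; apply: integral_exp.
  set p := iter_poly g r.+1.
  have -> : (map_poly (@ratr C) (t%:~R *: p)).[z] = t%:~R * (map_poly ratr p).[z].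
    by rewrite map_polyZ hornerZ; congr (_ * _); apply: rmorph_int.
  by rewrite /p map_iter_poly horner_iter_poly; apply: St; apply: Sg.
rewrite l1 l2 !normrX normrN !normrM !normrX normr_nat !exprMn -!exprM.
(* The powers of [a] in the two leading coefficients agree up to [e N], by the geometric sum for
   [e r.+1]. *)
have -> : (D * e N * D ^ r = e r.+1 * E + e N)%N.
  have : (D.-1 * e r.+1 = D ^ r.+1 - 1)%N by apply: iter_expE; apply: ltnW.
  have : (0 < D ^ r.+1)%N by rewrite expn_gt0 ltnW.
  by rewrite mulnAC -expnS /E mulnCA mulnA => ? ->; nia.
rewrite exprD -2!exprMn [X in X < _]mulrA [X in _ < X]mulrCA [X in X < _]mulrC.
rewrite ltr_pM2l ?exprn_gt0 //.
have hr' : `|t%:~R| ^+ E < 2 ^+ (D ^ r) * `|a| ^+ e N.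
  rewrite -ltr_pdivrMr ?exprn_gt0 //; apply: lt_le_trans hr _.
  by rewrite ler_weXn2l // ltnW // ltn_expl.
apply: (@lt_le_trans _ _ ((2 * A) ^+ (D ^ r) * (2 ^+ (D ^ r) * `|a| ^+ e N))).
  by rewrite ltr_pM2l // exprn_gt0 // mulr_gt0.
rewrite mulrA -exprMn ler_wpM2r ?exprn_ge0 // lerXn2r ?nnegrE ?mulr_ge0 ?(ltW A0) //.
by rewrite mulrC.
Qed.

(** * Finite differences *)

Definition fdiff (v : nat -> int) (s : nat) : int := v s.+1 - v s.

Lemma iter_fdiffD (a b : nat -> int) n s :
  iter n fdiff (fun i => a i + b i) s = iter n fdiff a s + iter n fdiff b s.
Proof. by elim: n s => //= n IH s; rewrite /fdiff !IH; ring. Qed.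

Lemma iter_fdiffB (a b : nat -> int) n s :
  iter n fdiff (fun i => a i - b i) s = iter n fdiff a s - iter n fdiff b s.
Proof. by elim: n s => //= n IH s; rewrite /fdiff !IH; ring. Qed.

Lemma iter_fdiff_shift (v : nat -> int) n s :
  iter n fdiff (fun i => v i.+1) s = iter n fdiff v s.+1.
Proof. by elim: n s => //= n IH s; rewrite /fdiff !IH. Qed.

Lemma iter_fdiff_bound (v : nat -> int) (c n s : nat) :
  (forall i, `|v i| <= c%:Z) -> `|iter n fdiff v s| <= (c * 2 ^ n)%N%:Z.
Proof.
move=> vc; elim: n s => [|n IH] s /=; first by rewrite muln1.
have := IH s.+1; have := IH s; rewrite /fdiff expnS mulnCA; lia.
Qed.

Lemma iter_fdiff_vanish (v : nat -> int) n :
  (forall s, (s <= n)%N -> v s = 0) -> iter n fdiff v 0%N = 0.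
Proof.
elim: n v => [|n IH] v v0; first exact: v0.
by rewrite iterSr IH // => s sn; rewrite /fdiff !v0 // ltnW.
Qed.

Lemma newton_forward (v : nat -> int) n s : (s < n)%N ->
  v s = \sum_(i < n) iter i fdiff v 0%N *+ 'C(s, i).
Proof.
elim: s v n => [|s IH] v [|n] // sn.
  by rewrite big_ord_recl /= bin0 big1 ?addr0.
rewrite big_ord_recl bin0 /=.
under eq_bigr => i _ do rewrite /bump leq0n add1n binS mulrnDr.
rewrite big_split addrA /=.
have -> : v s.+1 = v s + fdiff v s by rewrite /fdiff; ring.
congr (_ + _); first by rewrite (IH v n.+1 (ltnW sn)) big_ord_recl bin0.
rewrite (IH (fdiff v) n) //.
by apply: eq_bigr => i _; rewrite -iterSr.
Qed.

Definition binom_poly (i : nat) : {poly rat} :=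
  i`!%:R^-1 *: \prod_(j < i) ('X - (j%:R)%:P).

Lemma size_binom_poly i : (size (binom_poly i) <= i.+1)%N.
Proof.
apply: leq_trans (size_scale_leq _ _) _.
by rewrite size_prod_XsubC [index_enum _]unlock -enumT size_enum_ord.
Qed.

Lemma horner_binom_poly i s : (binom_poly i).[s%:R] = 'C(s, i)%:R.
Proof.
rewrite /binom_poly hornerZ horner_prod.
have -> : \prod_(j < i) ('X - (j%:R)%:P).[s%:R] = (s ^_ i)%:R :> rat.
  elim: i => [|i IH]; first by rewrite big_ord0.
  rewrite big_ord_recr /= IH ffactnSr natrM hornerXsubC.
  have [is_|si] := leqP i s; first by rewrite natrB.
  by rewrite ffact_small // !mul0r.
by rewrite -bin_ffact natrM mulrC mulfK // pnatr_eq0 -lt0n fact_gt0.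
Qed.

(** Truncate Newton's forward series after order [d]. A later term of order below [L] is a
    difference of vanishing differences; from order [L] on, the binomial coefficient is 0. *)
Lemma newton_interpolation (v : nat -> int) (d L : nat) :
  (forall s, (s + d.+1 < L)%N -> iter d.+1 fdiff v s = 0) ->
  exists p : {poly rat}, (size p <= d.+1)%N /\
    forall s, (s < L)%N -> p.[s%:R] = (v s)%:~R.
Proof.
move=> v0; exists (\sum_(i < d.+1) (iter i fdiff v 0%N)%:~R *: binom_poly i); split.
  apply: leq_trans (size_sum _ _ _) _; apply/bigmax_leqP => i _.
  apply: leq_trans (size_scale_leq _ _) _.
  exact: leq_trans (size_binom_poly i) _.
move=> s sL; rewrite (@newton_forward v (d.+1 + L) s); last by rewrite ltn_addl.
have tail : \sum_(j < L) iter (rshift d.+1 j) fdiff v 0%N *+ 'C(s, rshift d.+1 j) = 0.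
  rewrite big1 // => j _.
  have -> : (rshift d.+1 j = j + d.+1 :> nat)%N by exact: addnC.
  have [jL|Lj] := ltnP (j + d.+1) L; last first.
    by rewrite bin_small ?mulr0n // (leq_trans sL).
  rewrite iterD iter_fdiff_vanish ?mul0rn // => i ij; apply: v0.
  by apply: leq_ltn_trans jL; rewrite leq_add2r.
rewrite big_split_ord tail /= addr0.
rewrite horner_sum rmorph_sum; apply: eq_bigr => i _.
by rewrite hornerZ horner_binom_poly rmorphMn /= mulr_natr.
Qed.

(* With [E] the shift, the coefficients of [(1 + E) (E - 1) ^ 9] have absolute
   sum 252, less than half of the sum 2 ^ 9 for [(E - 1) ^ 9]: the pigeonhole
   count below needs this factor 2. *)
Lemma fdiff9_pair_bound (v : nat -> int) (m : int) s :
  (forall i, 0 <= v i <= m) ->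
  `|iter 9 fdiff v s + iter 9 fdiff v s.+1| <= 126 * m.
Proof.
move=> vm; rewrite /= /fdiff.
move: (vm s) (vm s.+1) (vm s.+2) (vm s.+3) (vm s.+4) (vm s.+4.+1) (vm s.+4.+2)
  (vm s.+4.+3) (vm s.+4.+4) (vm s.+4.+4.+1) (vm s.+4.+4.+2).
lia.
Qed.

(** * Compression by pigeonhole *)

(* Only functions attaining the value 0 are used, so that two distinct ones
   never differ by a constant. *)
Lemma pigeonhole_min0 (b L n a0 a1 : nat) (S : {ffun 'I_L -> 'I_b.+1} -> int)
    (W : 'I_n -> {ffun 'I_L -> 'I_b.+1} -> int) :
  (forall u, `|S u| <= a0%:Z) -> (forall j u, `|W j u| <= a1%:Z) ->
  ((2 * a0).+1 * (2 * a1).+1 ^ n + b ^ L < b.+1 ^ L)%N ->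
  exists u u' : {ffun 'I_L -> 'I_b.+1},
    [/\ u != u', exists i, u i = ord0, exists i, u' i = ord0,
        S u = S u' & forall j, W j u = W j u'].
Proof.
move=> Sb Wb card.
pose U : {set {ffun 'I_L -> 'I_b.+1}} :=
  [set u : {ffun _ -> _} | [exists i, u i == ord0]]%SET.
pose code a (w : int) : 'I_(2 * a).+1 := inord (absz (w + a%:Z)).
have codeI a w w' : `|w| <= a%:Z -> `|w'| <= a%:Z -> code a w = code a w' -> w = w'.
  move=> wa wa' /(congr1 (@nat_of_ord _)); rewrite !inordK; lia.
pose F u := (code a0 (S u), [ffun j => code a1 (W j u)]).
have cU : (b.+1 ^ L - b ^ L = #|U|)%N.
  have -> : (b ^ L)%N = #|(~: U)%SET|.
    have <- : #|(ffun_on (predC1 ord0) : {pred {ffun 'I_L -> 'I_b.+1}})| = (b ^ L)%N.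
      by rewrite card_ffun_on cardC1 !card_ord.
    apply: eq_card => u; rewrite !inE negb_exists.
    by apply/ffun_onP/forallP => h i; have := h i; rewrite inE.
  by rewrite [RHS]cardsCs card_ffun !card_ord.
apply: contrapT => nE.
have inj : {in U &, injective F}.
  move=> u u'; rewrite !inE => /existsP[i /eqP ui] /existsP[i' /eqP ui'] [E0 E1].
  apply/eqP/negPn/negP => uu'; apply: nE; exists u, u'; split=> //.
  - by exists i.
  - by exists i'.
  - exact: codeI E0.
  by move=> j; move/ffunP/(_ j): E1; rewrite !ffunE; apply: codeI.
have := max_card (mem (F @: U)%SET); rewrite (card_in_imset inj) -cU.
rewrite card_prod card_ffun !card_ord leq_subLR addnC => h.
by have := leq_trans card h; rewrite ltnn.
Qed.

(** Extension by 0 keeps the values between 0 and [b] everywhere, so bounds on differences need no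
    condition on the index. *)
Definition extend0 (L b : nat) (u : {ffun 'I_L -> 'I_b.+1}) (s : nat) : int :=
  if insub s is Some i then (u i : nat)%:Z else 0.

Lemma extend0E L b (u : {ffun 'I_L -> 'I_b.+1}) (i : 'I_L) :
  extend0 u i = (u i : nat)%:Z.
Proof. by rewrite /extend0 valK. Qed.

Lemma extend0_bound L b (u : {ffun 'I_L -> 'I_b.+1}) s :
  0 <= extend0 u s <= b%:Z.
Proof.
rewrite /extend0; case: insubP => [i _ _|_]; last by [].
by have := ltn_ord (u i); lia.
Qed.

(** [v] is the difference of two functions into [{0, ..., b}] found by pigeonhole to share their
    [k - 1] differences of order [d + 1]. *)
Lemma compressed_values (d k : nat) : (2 <= k)%N -> (2 ^ k <= d)%N ->
  exists v : nat -> int,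
    [/\ forall s, `|v s| <= (2 ^ k.-1 - 1)%N%:Z,
        exists i j, [/\ (i < d + k)%N, (j < d + k)%N & v i != v j] &
        forall s, (s + d.+1 < d + k)%N -> iter d.+1 fdiff v s = 0].
Proof.
move=> k2 kd; set b := (2 ^ k.-1 - 1)%N; set L := (d + k)%N.
have b1 : b.+1 = (2 ^ k.-1)%N by rewrite /b subn1 prednK // expn_gt0.
pose w s (u : {ffun 'I_L -> 'I_b.+1}) := iter d.+1 fdiff (extend0 u) s.
have wb s u : `|w s u| <= (b * 2 ^ d)%N%:Z.
  (* The first of the [d + 1] differences costs no factor 2, since values in [[0, b]] differ by at
     most [b]. *)
  rewrite /w iterSr; apply: iter_fdiff_bound => i.
  by have := extend0_bound u i; have := extend0_bound u i.+1; rewrite /fdiff; lia.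
suff [u [u' [uu' [i ui] [i' ui'] wE]]] : exists u u' : {ffun 'I_L -> 'I_b.+1},
    [/\ u != u', exists i, u i = ord0, exists i, u' i = ord0 &
        forall s, (s < k.-1)%N -> w s u = w s u'].
  exists (fun s => extend0 u s - extend0 u' s); split.
  - by move=> s; have := extend0_bound u s; have := extend0_bound u' s; lia.
  (* A constant difference would be at most 0 at a zero of [u] and at least 0 at a zero of [u'], so
     the two functions would coincide. *)
  - apply: contrapT => nE.
    have cst i1 i2 : extend0 u (i1 : 'I_L) - extend0 u' i1 = extend0 u (i2 : 'I_L) - extend0 u' i2.
      by apply/eqP/negPn/negP => h; apply: nE; exists i1, i2.
    case/negP: uu'; apply/eqP/ffunP => j; apply: val_inj.
    have := cst j i; have := cst j i'; rewrite !extend0E ui ui' /=; lia.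
  - move=> s sL; rewrite iter_fdiffB; apply/eqP; rewrite subr_eq0; apply/eqP.
    by apply: wE; move: sL; rewrite /L; lia.
have [k3|k3] : k = 2 \/ (3 <= k)%N by lia.
  have bE : b = 1%N by rewrite /b k3.
  have [|||u [u' [uu' u0 u0' Swu _]]] := @pigeonhole_min0 b L 0 (b * 2 ^ d) 0 (w 0%N) (fun _ _ => 0).
  - exact: wb.
  - by [].
  - rewrite /L k3 bE expn0 exp1n mul1n muln1 expnD -[(2 ^ 2)%N]/4%N.
    have : (4 <= 2 ^ d)%N by apply: (@leq_pexp2l 2 2 d) => //; move: kd; rewrite k3; lia.
    lia.
  exists u, u'; split=> // s; rewrite k3; case: s => //.
have d8 : (8 <= d)%N by apply: leq_trans kd; apply: (@leq_pexp2l 2 3 k).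
(* Replacing [w 0] by [w 0 + w 1] loses nothing once [w 1] is also recorded, and its smaller range
   saves the factor 2 that pays for the functions without zeros. *)
pose S u := w 0%N u + w 1%N u.
have Sb u : `|S u| <= (b * (126 * 2 ^ (d - 8)))%N%:Z.
  pose y i := iter 9 fdiff (extend0 u) i + iter 9 fdiff (extend0 u) i.+1.
  have -> : S u = iter (d - 8) fdiff y 0%N.
    rewrite /S /w /y iter_fdiffD iter_fdiff_shift -!iterD.
    by rewrite (_ : (d - 8 + 9 = d.+1)%N) //; lia.
  rewrite mulnA; apply: iter_fdiff_bound => i.
  rewrite mulnC PoszM; apply: fdiff9_pair_bound => j; exact: extend0_bound.
have [|||u [u' [uu' u0 u0' Swu Ww]]] := @pigeonhole_min0 b L k.-2 (b * (126 * 2 ^ (d - 8))) (b * 2 ^ d) S (fun j => w j.+1).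
- exact: Sb.
- by move=> j; apply: wb.
- have XE : (2 ^ L = 2 * (b.+1 * 2 ^ d))%N.
    by rewrite b1 mulnA -expnS prednK ?(ltnW k2) // -expnD addnC.
  have TE : (2 ^ d = 256 * 2 ^ (d - 8))%N.
    by rewrite -[256%N]/(2 ^ 8)%N -expnD subnKC.
  have P0 : (0 < 2 ^ (d - 8))%N by rewrite expn_gt0.
  have b0 : (0 < b)%N by rewrite -ltnS b1; apply: (@leq_pexp2l 2 1 k.-1) => //; lia.
  have A2 : (2 * (2 * (b * (126 * 2 ^ (d - 8)))).+1 <= 2 ^ L)%N by rewrite XE TE; nia.
  have Y2 : ((2 * (b * 2 ^ d)).+1 ^ k.-2 < (2 ^ L) ^ k.-2)%N.
    by rewrite ltn_exp2r; [rewrite XE TE; nia | lia].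
  have BE : (b.+1 ^ L = 2 ^ L * (2 ^ L) ^ k.-2)%N.
    by rewrite b1 -!expnM -expnD; congr (2 ^ _)%N; nia.
  have Lb : (b <= L)%N.
    rewrite -ltnS b1; apply: (@leq_trans (2 ^ k)); last by rewrite /L; lia.
    by rewrite leq_pexp2l // leq_pred.
  (* By Bernoulli's inequality and [b <= L], at least half of the functions take the value 0. *)
  have C2 : (2 * b ^ L <= b.+1 ^ L)%N.
    have bern n : (b ^ n * b + n * b ^ n <= b.+1 ^ n * b)%N.
      elim: n => [|n IH]; first by rewrite !expn0; lia.
      by rewrite !expnS; nia.
    rewrite -(leq_pmul2r b0); apply: leq_trans (bern L); nia.
  rewrite -(ltn_pmul2l (isT : 0 < 2)%N) mulnDr.
  have X0 : (0 < 2 ^ L)%N by rewrite expn_gt0.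
  have h1 := leq_mul A2 (leqnn ((2 * (b * 2 ^ d)).+1 ^ k.-2)).
  move: Y2; rewrite -(ltn_pmul2l X0) -BE => h2.
  rewrite mulnA [X in (_ < X)%N]mul2n -addnn -addSn leq_add //.
  exact: leq_ltn_trans h1 h2.
exists u, u'; split=> // s sk.
have w1 : w 1%N u = w 1%N u' by have := Ww (Ordinal (_ : 0 < k.-2)%N); apply; lia.
case: s sk => [|s] sk; first by move: Swu; rewrite /S w1 => /addIr.
by have := Ww (Ordinal (_ : s < k.-2)%N); apply; lia.
Qed.

Lemma compressing_poly (d : nat) : (2 <= d)%N ->
  exists f : {poly rat}, (2 < size f <= d.+1)%N /\
    forall s, (s < d + trunc_log 2 d)%N -> exists2 w, (w < d)%N & f.[s%:R] = w%:R.
Proof.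
move=> d2; set k := trunc_log 2 d.
have kd : (2 ^ k <= d)%N by apply: trunc_logP => //; apply: ltnW.
have dk : (d < 2 ^ k.+1)%N by apply: trunc_log_ltn.
have k1 : (0 < k)%N.
  by rewrite lt0n; apply/eqP => k0; move: dk; rewrite k0 => /(leq_ltn_trans d2).
suff [v [vd [i [j [id_ jd vij]]] v0]] : exists v : nat -> int,
    [/\ forall s, 0 <= v s < d%:Z,
        exists i j, [/\ (i < d + k)%N, (j < d + k)%N & v i != v j] &
        forall s, (s + d.+1 < d + k)%N -> iter d.+1 fdiff v s = 0].
  have [f [szf fv]] := newton_interpolation v0.
  have fw s : (s < d + k)%N -> exists2 w, (w < d)%N & f.[s%:R] = w%:R.
    by move=> sL; exists (absz (v s)); have := vd s; [lia | rewrite fv //; case: (v s)].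
  (* A nonconstant polynomial of degree at most 1 is injective, so it cannot send [d + k] points to
     [d] values. *)
  exists f; split=> //; rewrite szf andbT ltnNge; apply/negP => sz2.
  have fE x : f.[x] = f`_0 + f`_1 * x.
    by rewrite (horner_coef_wide _ sz2) !big_ord_recl big_ord0 /= addr0 expr0 mulr1 expr1.
  have fij : f.[i%:R] != f.[j%:R] by rewrite !fv // eqr_int.
  have f1 : f`_1 != 0 by apply: contra fij; rewrite !fE => /eqP ->; rewrite !mul0r.
  have /choice[w wE] : forall s : 'I_(d + k), exists w : 'I_d, f.[s%:R] = w%:R.
    by move=> s; have [w wd E] := fw s (ltn_ord s); exists (Ordinal wd).
  have : injective w.
    move=> s s' ss; apply: val_inj; apply/eqP; rewrite -(eqr_nat rat); apply/eqP.
    have := wE s; rewrite ss -wE !fE => /addrI; exact: mulfI.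
  by move/leq_card; rewrite !card_ord; lia.
(* For [k = 1] no difference has to vanish, and any nonconstant function with values 0 and 1 will
   do. *)
have [k1'|k2] : k = 1%N \/ (2 <= k)%N by lia.
  exists (fun s => (s == 0%N)%:Z); split.
  - by move=> s; case: (s == 0%N); lia.
  - by exists 0%N, 1%N; split=> //; lia.
  - by move=> s; rewrite k1'; lia.
have [v [vb vn v0]] := compressed_values k2 kd.
pose m := (2 ^ k.-1 - 1)%N.
have mk : (2 * m < d)%N.
  have : (2 * 2 ^ k.-1 = 2 ^ k)%N by rewrite -expnS prednK.
  have : (0 < 2 ^ k.-1)%N by rewrite expn_gt0.
  by rewrite /m; move: kd; lia.
(* Translation moves [[-m, m]] to [[0, 2 * m]], inside [[0, d - 1]], without changing differences of
   positive order. *)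
exists (fun s => v s + m%:Z); split.
- by move=> s; have := vb s; rewrite -/m; lia.
- case: vn => i [j [? ? h]]; exists i, j; split=> //.
  by apply: contra h => /eqP /addIr ->.
- move=> s sL; rewrite iter_fdiffD v0 // add0r.
  rewrite iterSr; apply/eqP; rewrite -normr_le0.
  apply: le_trans (@iter_fdiff_bound _ 0 _ _ _) _ => [i|]; last by rewrite mul0n.
  by rewrite /fdiff subrr.
Qed.

(** * Counting preimages *)

Lemma dvdp_deriv_radical (K : fieldType) (r : seq K) :
  \prod_(z <- r) ('X - z%:P) %|
    (\prod_(z <- r) ('X - z%:P))^`() * \prod_(z <- undup r) ('X - z%:P).
Proof.
elim: r => [|z r IH]; first by rewrite !big_nil dvd1p.
rewrite big_cons; set q := \prod_(_ <- r) _ in IH *.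
rewrite derivM derivXsubC mul1r [X in _ %| X]mulrDl.
have zq : ('X - z%:P) * q %| ('X - z%:P) * q^`() * \prod_(y <- undup r) ('X - y%:P).
  by rewrite -mulrA dvdp_mul2l ?polyXsubC_eq0.
rewrite /=; case: ifP => zr.
  apply: dvdp_add => //; rewrite mulrC dvdp_mul // dvdp_XsubCl root_prod_XsubC.
  by rewrite mem_undup.
rewrite big_cons; apply: dvdp_add; first by rewrite mulrCA mulrA dvdp_mulIl.
by rewrite mulrCA dvdp_mull.
Qed.

(** The polynomials [F w] are pairwise coprime and share the derivative of [f], so their product
    divides that derivative times the radical [Q] of the product. Comparing degrees bounds the
    degree of [Q] from below. *)
Lemma distinct_preimages (C : numClosedFieldType) (f : {poly C}) (d : nat) :
  (1 < size f)%N -> (0 < d)%N ->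
  exists s : seq C,
    [/\ uniq s, ((size f).-1 * (d - 1) + 1 <= size s)%N &
        forall z, z \in s -> exists2 w, (w < d)%N & f.[z] = w%:R].
Proof.
move=> f1 d0; set D := (size f).-1.
have szf : size f = D.+1 by rewrite prednK // ltnW.
have D0 : (0 < D)%N by rewrite -ltnS -szf.
pose F (w : nat) : {poly C} := f - (w%:R)%:P.
have szF w : size (F w) = D.+1.
  by rewrite size_polyDl ?szf // size_polyN (leq_ltn_trans (size_polyC_leq1 _)).
have F0 w : F w != 0 by rewrite -size_poly_gt0 szF.
have rootF w z : root (F w) z = (f.[z] == w%:R).
  by rewrite rootE hornerD hornerN hornerC subr_eq0.
have f'0 : f^`() != 0.
  apply/eqP => /(congr1 (fun p : {poly C} => p`_D.-1)).
  rewrite coef_deriv coef0 prednK // => /eqP; rewrite mulrn_eq0 eqn0Ngt D0 /=.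
  by rewrite -/(lead_coef f) lead_coef_eq0 -size_poly_eq0 szf.
pose P n := \prod_(w < n) F w.
have [r rE] := closed_field_poly_normal (P d).
have P0 n : P n != 0 by apply/prodf_neq0 => w _; apply: F0.
have lP0 : lead_coef (P d) != 0 by rewrite lead_coef_eq0.
have rootP z : root (P d) z = (z \in r) by rewrite rE rootZ // root_prod_XsubC.
have rootPn n z : root (P n) z -> exists2 w, (w < n)%N & f.[z] = w%:R.
  elim: n => [|n IH]; first by rewrite /P big_ord0 (negPf (root1 z)).
  rewrite /P big_ord_recr /= rootM => /orP[/IH[w wn ?]|].
    by exists w => //; apply: ltnW.
  by rewrite rootF => /eqP; exists n.
exists (undup r); split; first exact: undup_uniq; last first.
  by move=> z; rewrite mem_undup -rootP => /rootPn.
pose Q : {poly C} := \prod_(z <- undup r) ('X - z%:P).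
have FQ w : (w < d)%N -> F w %| f^`() * Q.
  move=> wd; have [rw rwE] := closed_field_poly_normal (F w).
  have l0 : lead_coef (F w) != 0 by rewrite lead_coef_eq0.
  have -> : f^`() = (F w)^`() by rewrite derivB derivC subr0.
  rewrite rwE derivZ -scalerAl dvdpZl // dvdpZr //.
  apply: dvdp_trans (dvdp_deriv_radical rw) _; apply: dvdp_mul => //.
  apply: uniq_roots_dvdp; last by rewrite uniq_rootsE undup_uniq.
  apply/allP => z; rewrite mem_undup => zr; rewrite root_prod_XsubC mem_undup -rootP.
  rewrite /P (bigD1 (Ordinal wd)) //= rootM; apply/orP; left.
  by rewrite rwE rootZ // root_prod_XsubC.
have PQ n : (n <= d)%N -> P n %| f^`() * Q.
  elim: n => [|n IH] nd; first by rewrite /P big_ord0 dvd1p.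
  rewrite /P big_ord_recr /= Gauss_dvdp; first by rewrite (IH (ltnW nd)) (FQ n nd).
  apply: Pdiv.ClosedField.root_coprimep => z /rootPn[w wn fz].
  by rewrite -rootE rootF fz eqr_nat ltn_eqF.
have := dvdp_leq _ (PQ d (leqnn d)).
rewrite mulf_neq0 // ?prodf_seq_neq0; last by apply/allP => z _; rewrite polyXsubC_eq0.
move=> /(_ isT).
rewrite size_prod => [|w _]; last exact: F0.
rewrite (eq_bigr (fun=> D.+1)) => [|w _]; last exact: szF.
rewrite sum_nat_const card_ord.
rewrite size_mul // ?prodf_seq_neq0; last by apply/allP => z _; rewrite polyXsubC_eq0.
rewrite size_prod_XsubC; have := lt_size_deriv (_ : f != 0); rewrite -size_poly_gt0 szf => /(_ isT).
have -> : ((d * D.+1).+1 - d = (D * d).+1)%N by rewrite mulnS -addnS addKn mulnC.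
by have := leq_pmulr D d0; rewrite mulnBr muln1; move: (D * d)%N (size _) (size _) => x y z; lia.
Qed.

Lemma card_ge_uniq (T : choiceType) (A : set T) (s : seq T) n :
  uniq s -> (n <= size s)%N -> (forall z, z \in s -> A z) -> `I_n #<= A.
Proof.
move=> us ns sA; apply: (@card_le_trans _ _ _ [set` s]); last exact: subset_card_le.
have -> : [set` s] = [set` [fset z in s]%fset].
  by apply/seteqP; split=> z /=; rewrite !inE.
have /card_eq_fsetP/card_esym := erefl #|` [fset z in s]%fset|.
move=> /card_eqPle[+ _]; apply: card_le_trans; rewrite card_le_II.
by rewrite card_fseq undup_id.
Qed.

Lemma preperiodic_invariant (K : fieldType) (f : {poly K}) (A : set K) (a : K) :
  finite_set A -> (forall x, A x -> A f.[x]) -> A a -> preperiodic f a.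
Proof.
move=> finA fA Aa; apply: sub_finite_set finA => _ [n _ <-].
by elim: n => //= n IH; apply: fA.
Qed.

Lemma preperiodic_nat (K : fieldType) (f : {poly K}) (L n : nat) :
  (forall m, (m < L)%N -> exists2 w, (w < L)%N & f.[m%:R] = w%:R) ->
  (n < L)%N -> preperiodic f n%:R.
Proof.
move=> fL nL; apply: (@preperiodic_invariant _ _ [set m%:R | m in `I_L]).
- exact/finite_image/finite_II.
- by move=> _ [m /fL[w wL E] <-]; exists w; rewrite // E.
- by exists n.
Qed.

Lemma preperiodic_horner (K : fieldType) (f : {poly K}) (a : K) :
  preperiodic f f.[a] -> preperiodic f a.
Proof.
move=> ffa; apply: (@sub_finite_set _ _ ([set a] `|` orbit_of f f.[a])); last first.
  by rewrite finite_setU; split=> //; apply: finite_set1.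
move=> _ [[|n] _ <-]; first by left.
by right; exists n; rewrite // -iterSr.
Qed.

Theorem theorem1p3 (R : realType) (d : nat) (hd : (2 <= d)%N) :
  exists f : {poly rat},
    [/\ (2 <= (size f).-1 <= d)%N,
        `I_(d + trunc_log 2 d) #<= PrePer f,
        forall i j : nat, (i < j)%N -> (j <= trunc_log 2 d)%N ->
          finite_set (PrePer (shift_over R[i] f i) `&`
                      PrePer (shift_over R[i] f j))
      & `I_((size f).-1 * (d - 1) + 1) #<=
          \bigcap_(i < (trunc_log 2 d).+1) PrePer (shift_over R[i] f i)].
Proof.
have [f [/andP[szf szfd] fN]] := compressing_poly hd.
set k := trunc_log 2 d in fN *.
have shiftN i m (w : nat) : f.[m] = w%:R ->
    (shift_over R[i] f i).[ratr m] = (w + i)%:R.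
  move=> fm; rewrite /shift_over horner_map /= hornerD hornerC fm.
  by rewrite -natrD rmorph_nat.
have shiftE i z : (shift_over R[i] f i).[z] = (map_poly ratr f).[z] + i%:R.
  rewrite /shift_over raddfD /= hornerD map_polyC hornerC; congr (_ + _).
  exact: rmorph_nat.
(* Adding [i <= k] to a value below [d] stays below [d + k], so every translate preserves the same
   finite set. *)
have small i n : (i <= k)%N -> (n < d + k)%N -> preperiodic (shift_over R[i] f i) n%:R.
  move=> ik; apply: preperiodic_nat => m /fN[w wd fm]; exists (w + i)%N; first by lia.
  by rewrite -(rmorph_nat (@ratr R[i]) m) (shiftN _ _ w).
exists f; split.
- by rewrite -ltnS prednK ?szf //; lia.
- apply: (@card_ge_uniq _ _ [seq n%:R | n <- iota 0 (d + k)]).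
  + by rewrite map_inj_uniq ?iota_uniq //; apply: mulrIn; apply: oner_neq0.
  + by rewrite size_map size_iota.
  + move=> z /mapP[n]; rewrite mem_iota /= add0n => nL ->.
    apply: preperiodic_nat nL => m /fN[w wd fm]; exists w => //.
    by rewrite ltn_addr.
- move=> i j ij jk; rewrite /shift_over.
  have -> : f + (j%:R)%:P = (f + (i%:R)%:P) + ((j - i)%:R)%:P.
    by rewrite -addrA -polyCD -natrD subnKC // ltnW.
  apply: finite_PrePer_shift; last by rewrite pnatr_eq0 subn_eq0 -ltnNge.
  by rewrite size_polyDl // (leq_ltn_trans (size_polyC_leq1 _)) // ltnW.
have szC : size (map_poly (@ratr R[i]) f) = size f by rewrite size_map_poly.
have f1 : (1 < size (map_poly (@ratr R[i]) f))%N by rewrite szC ltnW.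
have [s [us sz sP]] := distinct_preimages f1 (ltnW hd); rewrite szC in sz.
apply: (card_ge_uniq us sz) => z zs i /= ik; have [w wd fz] := sP z zs.
by apply: preperiodic_horner; rewrite shiftE fz -natrD; apply: small; lia.
Qed.
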